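(* Let $k\ge 2$ and let $Q=\frac1k(Q_1+\cdots+Q_k)$ be a balanced multi-class input distribution on $\mathbb{R}^d$ with $k$ classes, where $Q_i$ is the input distribution of class $i$. Suppose that $Q$ satisfies the Poincaré inequality with some constant $c$. Let $f:\mathbb{R}^d\to\mathbb{R}^p$ be a network embedding (a differentiable feature map). Then $$ \operatorname{NC}(f,Q)\;\le\;\frac{c\cdot \operatorname{GC}(f,Q)}{k-1}\left(\sum_{i\neq j}\frac{1}{d_{ij}^2}\right), $$ where $d_{ij}=\|\mu_f(Q_i)-\mu_f(Q_j)\|$ is the distance between the mean of class $i$ and the mean of class $j$ in embedding space.
   Context: $\|\cdot\|$ is the Euclidean norm and $\|\cdot\|_F$ the Frobenius norm. Distributions are written $Q=q(x)dx$ and $Q_i=q_i(x)dx$. For a distribution $R=r(x)dx$ on $\mathbb{R}^d$ and a map $f:\mathbb{R}^d\to\mathbb{R}^p$: - Mean: $\mu_f(R)=\mathbb{E}_{x\sim R}[f(x)]$. - Variance: $\operatorname{Var}_f(R)=\int\|\mu_f(R)-f(x)\|^2\,r(x)\,dx$. - Geometric complexity: $\operatorname{GC}(f,R)=\mathbb{E}_{x\sim R}\left[\|\nabla_x f(x)\|_F^2\right]$, where $\nabla_x f$ is the Jacobian of $f$. - Class-distance normalized variance: $V_f(Q_i,Q_j)=\dfrac{\operatorname{Var}_f(Q_i)+\operatorname{Var}_f(Q_j)}{2\|\mu_f(Q_i)-\mu_f(Q_j)\|^2}$. - Neural collapse measure: $\operatorname{NC}(f,Q)=\operatorname{Avg}_{i\ne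 j}\,V_f(Q_i,Q_j)=\frac{1}{k(k-1)}\sum_{i\neq j}V_f(Q_i,Q_j)$. Here and in the claim, $\sum_{i\ne j}$ runs over ordered pairs of distinct classes $i,j\in\{1,\dots,k\}$. $Q$ satisfies the Poincaré inequality with constant $c$ if, for all differentiable (possibly vector-valued) functions $v$ defined on $\operatorname{supp}(Q)$, $\operatorname{Var}_v(Q)\le c\,\mathbb{E}_{x\sim Q}\left[\|\nabla_x v\|_F^2\right]=c\operatorname{GC}(v,Q)$. *)

(* Defs.v *)
From HB Require Import structures.
From mathcomp Require Import all_boot all_order all_algebra.
From mathcomp Require Import all_classical all_reals all_analysis measurable_realfun.

Set Implicit Arguments.
Unset Strict Implicit.
Unset Printing Implicit Defensive.

Import Order.TTheory GRing.Theory Num.Theory.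
Import numFieldNormedType.Exports.

Local Open Scope classical_set_scope.
Local Open Scope ring_scope.

Section borel_row_vectors.
Context (R : realType) (d : nat).

Let borel : set (set 'rV[R]_d) := <<s open >>.

Let borelC (A : set 'rV[R]_d) : borel A -> borel (~` A).
Proof. by move=> bA; rewrite -setTD; exact: sigma_algebraCD. Qed.

HB.instance Definition _ := @isMeasurable.Build
  (sigma_display (@open 'rV[R]_d)) 'rV[R]_d borel
  (@sigma_algebra0 _ setT open) borelC (@sigma_algebra_bigcup _ setT open).

End borel_row_vectors.

(* The library has no Lebesgue measure on R^d; on Borel sets it is given by
   Tonelli's formula, slicing along the first coordinate. The result is a bare
   set function, which is all that \int[_] requires. *)
Fixpoint lebesgue_rV (R : realType) (d : nat) : set 'rV[R]_d -> \bar R :=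
  match d return set 'rV[R]_d -> \bar R with
  | 0 => fun A => \d_(0 : 'rV[R]_0) A
  | n.+1 => fun A => (\int[@lebesgue_measure R]_t
      @lebesgue_rV R n [set y | A (row_mx (t%:M : 'rV[R]_1) y)])%E
  end.

Lemma lebesgue_rV0 (R : realType) (d : nat) : lebesgue_rV (set0 : set 'rV[R]_d) = 0%E.
Proof.
elim: d => [|m IHm] /=; first by rewrite diracE in_set0.
by rewrite integral0_eq.
Qed.

Lemma lebesgue_rV_box (R : realType) (d : nat) (a b : 'rV[R]_d) :
  (forall i, a 0 i <= b 0 i) ->
  lebesgue_rV [set x : 'rV[R]_d | forall i, a 0 i <= x 0 i <= b 0 i] =
  (\prod_(i < d) (b 0 i - a 0 i))%:E.
Proof.
elim: d a b => [|n IH] a b ab.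
  by rewrite big_ord0 /= diracE mem_set// => -[].
rewrite big_ord_recl /=.
pose a' : 'rV[R]_n := \row_i a 0 (lift ord0 i).
pose b' : 'rV[R]_n := \row_i b 0 (lift ord0 i).
have BE : lebesgue_rV [set x : 'rV[R]_n | forall i, a' 0 i <= x 0 i <= b' 0 i] =
  (\prod_(i < n) (b 0 (lift ord0 i) - a 0 (lift ord0 i)))%:E.
  rewrite IH; last by move=> i; rewrite !mxE.
  by congr (_%:E); apply: eq_bigr => i _; rewrite !mxE.
set B := [set x : 'rV[R]_n | _] in BE.
set r := \prod_(i < n) _ in BE *.
have r0 : 0 <= r by apply: prodr_ge0 => i _; rewrite subr_ge0.
have R0 (t : R) (y : 'rV_n) : (row_mx (t%:M : 'rV_1) y : 'rV_n.+1) 0 ord0 = t.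
  have /eqP -> : (row_mx (t%:M : 'rV_1) y) 0 (ord0 : 'I_(1 + n)) == (row_mx (t%:M : 'rV_1) y) 0 (lshift n (ord0 : 'I_1)).
    by apply/eqP; congr (fun_of_matrix _ _); exact/val_inj.
  by rewrite row_mxEl mxE eqxx mulr1n.
have RS (t : R) (y : 'rV_n) i : (row_mx (t%:M : 'rV_1) y : 'rV_n.+1) 0 (lift ord0 i) = y 0 i.
  have /eqP -> : (row_mx (t%:M : 'rV_1) y) 0 (lift ord0 i : 'I_(1 + n)) == (row_mx (t%:M : 'rV_1) y) 0 (rshift 1 i).
    by apply/eqP; congr (fun_of_matrix _ _); exact/val_inj.
  by rewrite row_mxEr.
transitivity (\int[@lebesgue_measure R]_t (r%:E * (\1_(`[a 0 ord0, b 0 ord0]%classic : set R) t)%:E))%E.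
  apply: eq_integral => t _; rewrite indicE.
  have [tab|tab] := boolP (t \in `[a 0 ord0, b 0 ord0]%classic).
    rewrite mule1 -BE; congr lebesgue_rV; apply/seteqP; split => y /= H i.
      by have := H (lift ord0 i); rewrite RS !mxE.
    case: (unliftP ord0 i) => [j|] ->.
      by have := H j; rewrite RS !mxE.
    by move: tab; rewrite inE /= in_itv /= R0.
  rewrite mule0 -[RHS](@lebesgue_rV0 R n); congr lebesgue_rV.
  apply/seteqP; split => // y /= /(_ ord0).
  rewrite R0 => H.
  by move: tab; rewrite notin_setE /= in_itv /= H.
rewrite ge0_integralZl//=; last first.
  by first [rewrite lee_fin | apply/measurable_EFinP; exact: measurable_indic].
rewrite integral_indic// setIT.
rewrite [X in (_ * X)%E](_ : _ = lebesgue_measure `[a 0 ord0, b 0 ord0]%classic)//.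
rewrite lebesgue_measure_itv /= lte_fin.
rewrite muleC; have := ab ord0; rewrite le_eqVlt => /orP[/eqP ->|->].
  by rewrite ltxx mul0e subrr mul0r.
by rewrite EFinM EFinB.
Qed.

(* P = r(x) dx *)
Definition has_density (R : realType) (d : nat) (P : probability 'rV[R]_d R)
    (r : 'rV[R]_d -> R) : Prop :=
  [/\ measurable_fun setT r, (forall x, 0 <= r x) &
      forall A, measurable A ->
        P A = (\int[@lebesgue_rV R d]_(x in A) (r x)%:E)%E].

Definition supp (R : realType) (d : nat) (P : probability 'rV[R]_d R) :
    set 'rV[R]_d :=
  [set x | forall U, open U -> U x -> (0 < P U)%E].

(* The library norm `|x| on 'rV[R]_p is the sup norm. *)
Definition enorm (R : realType) (p : nat) (x : 'rV[R]_p) : R :=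
  Num.sqrt (\sum_(i < p) x 0 i ^+ 2).

Definition frobenius (R : realType) (m n : nat) (A : 'M[R]_(m, n)) : R :=
  Num.sqrt (\sum_(i < m) \sum_(j < n) A i j ^+ 2).

(* E_P[f] exists (componentwise), so that mean below is meaningful. *)
Definition has_mean (R : realType) (d p : nat) (f : 'rV[R]_d -> 'rV[R]_p)
    (P : probability 'rV[R]_d R) : Prop :=
  forall j : 'I_p, P.-integrable setT (fun x => (f x 0 j)%:E).

Definition mean (R : realType) (d p : nat) (f : 'rV[R]_d -> 'rV[R]_p)
    (P : probability 'rV[R]_d R) : 'rV[R]_p :=
  \row_(j < p) fine ('E_P[fun x => (f x 0 j)%R])%E.

Definition Var (R : realType) (d p : nat) (f : 'rV[R]_d -> 'rV[R]_p)
    (P : probability 'rV[R]_d R) : \bar R :=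
  ('E_P[fun x => (enorm (mean f P - f x) ^+ 2)%R])%E.

(* 'J f x is the transpose of the usual Jacobian matrix (row vectors), which has
   the same Frobenius norm. *)
Definition GC (R : realType) (d p : nat) (f : 'rV[R]_d -> 'rV[R]_p)
    (P : probability 'rV[R]_d R) : \bar R :=
  ('E_P[fun x => (frobenius ('J f x) ^+ 2)%R])%E.

(* In \bar R, 0^-1 = +oo and 0 * +oo = 0. *)
Definition V (R : realType) (d p : nat) (f : 'rV[R]_d -> 'rV[R]_p)
    (P1 P2 : probability 'rV[R]_d R) : \bar R :=
  ((Var f P1 + Var f P2) / (2 * enorm (mean f P1 - mean f P2) ^+ 2)%R%:E)%E.

Definition NC (R : realType) (d p k : nat) (f : 'rV[R]_d -> 'rV[R]_p)
    (Qc : 'I_k -> probability 'rV[R]_d R) : \bar R :=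
  ((k%:R * (k%:R - 1))%R%:E^-1 *
    \sum_(i < k) \sum_(j < k | j != i) V f (Qc i) (Qc j))%E.

(* A function on supp P is given by an extension to R^d: differentiability is only
   required at the points of supp P. *)
Definition poincare (R : realType) (d : nat) (P : probability 'rV[R]_d R)
    (c : R) : Prop :=
  forall (m : nat) (v : 'rV[R]_d -> 'rV[R]_m),
    (forall x, supp P x -> differentiable v x) -> has_mean v P ->
    (Var v P <= c%:E * GC v P)%E.

(* P = (1/k) (Q_1 + ... + Q_k) *)
Definition balanced_mixture (R : realType) (d k : nat)
    (P : probability 'rV[R]_d R) (Qc : 'I_k -> probability 'rV[R]_d R) : Prop :=
  forall A, measurable A -> P A = (k%:R^-1%:E * \sum_(i < k) Qc i A)%E.

(* Main.v *)
(** The mean minimises the mean square distance, so Var(Q_i) + Var(Q_j) is at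
    most the sum of the mean square distances of f to mu(Q) under Q_i and Q_j.
    As Q_i + Q_j <= k Q for i <> j, this sum is at most k Var(Q), which the
    Poincaré inequality bounds by k c GC(Q). Dividing by 2 d_ij^2 and averaging
    over i <> j gives the claim, even with an extra factor 1/2. *)
Require Import Defs.
From mathcomp Require Import all_boot all_order all_algebra.
From mathcomp Require Import all_classical all_reals all_analysis.
From mathcomp Require Import measurable_realfun ring lra.

Import Order.TTheory GRing.Theory Num.Theory.
Import numFieldNormedType.Exports.

Local Open Scope classical_set_scope.
Local Open Scope ring_scope.

Lemma enorm_sqr (R : realType) (p : nat) (x : 'rV[R]_p) :
  enorm x ^+ 2 = \sum_(i < p) x 0 i ^+ 2.
Proof. by rewrite sqr_sqrtr// sumr_ge0// => i _; exact: sqr_ge0. Qed.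

Section mean_square.
Context (R : realType) (d p : nat).
Implicit Types (f : 'rV[R]_d -> 'rV[R]_p) (P Q : probability 'rV[R]_d R).

Lemma measurable_enorm_sqr f P (a : 'rV[R]_p) : has_mean f P ->
  measurable_fun setT (fun x => enorm (a - f x) ^+ 2).
Proof.
move=> hf.
under eq_fun do rewrite enorm_sqr.
apply: measurable_sum => j.
under eq_fun do rewrite !mxE.
apply: measurable_funX; apply: measurable_funB => //.
by apply/measurable_EFinP; exact: measurable_int (hf j).
Qed.

Lemma Var_ge0 f P : (0 <= Var f P)%E.
Proof. by rewrite /Var unlock integral_ge0// => x _; rewrite lee_fin sqr_ge0. Qed.

(** The difference of the squared distances of [f x] to [a] and to the mean is affine in [f x], and
    its integral is the squared distance from [a] to the mean. *)
Lemma Var_le_mean_square f P (a : 'rV[R]_p) : has_mean f P ->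
  (Var f P <= \int[P]_x (enorm (a - f x) ^+ 2)%:E)%E.
Proof.
move=> hf; rewrite /Var unlock; set m := mean f P.
set I := (\int[P]_x _)%E; set J := (\int[P]_x _)%E.
(* Apart from this trivial case the integrand of [J] is integrable, which allows the integral of a
   difference to be split below. *)
have [->|Joo] := eqVneq J +oo%E; first by rewrite leey.
have sqr_int : P.-integrable setT (fun x => (enorm (a - f x) ^+ 2)%:E).
  apply/integrableP; split.
    by apply/measurable_EFinP; exact: measurable_enorm_sqr hf.
  under eq_integral do rewrite gee0_abs ?lee_fin ?sqr_ge0//.
  by rewrite ltey.
have fE j : (\int[P]_x (f x 0 j)%:E = (m 0 j)%:E)%E.
  rewrite /m mxE unlock fineK//.
  exact: integrable_fin_num (hf j).
(* Coordinate [j] of that difference, with the squares of [f x 0 j] cancelled, so that a finite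
   first moment suffices for integrability. *)
pose h j x : \bar R :=
  ((2 * (m 0 j - a 0 j))%:E * (f x 0 j)%:E + (a 0 j ^+ 2 - m 0 j ^+ 2)%:E)%E.
have cst_int (r : R) : P.-integrable setT (fun=> r%:E).
  exact: finite_measure_integrable_cst.
have h_int j : P.-integrable setT (h j).
  by apply: integrableD => //; apply: integrableZl.
have hE j : (\int[P]_x h j x = ((m 0 j - a 0 j) ^+ 2)%:E)%E.
  rewrite integralD//; last exact: integrableZl.
  rewrite integralZl// fE integral_cst//.
  rewrite [X in (_ + _ * X)%E](probability_setT P) mule1 -EFinM -EFinD.
  by congr (_%:E); ring.
have -> : I = (\int[P]_x ((enorm (a - f x) ^+ 2)%:E - \sum_(j < p) h j x))%E.
  apply: eq_integral => x _; rewrite sumEFin -EFinB; congr (_%:E).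
  rewrite !enorm_sqr -sumrB; apply: eq_bigr => j _.
  by rewrite !mxE; ring.
rewrite integralB//; last exact: integrable_sum.
rewrite integral_sum//; under eq_bigr do rewrite hE.
rewrite -/J sumEFin leeBlDr// leeDl// lee_fin sumr_ge0// => j _.
exact: sqr_ge0.
Qed.

End mean_square.

Section mixture.
Context (R : realType) (d p k : nat).
Variables (Q : probability 'rV[R]_d R) (Qc : 'I_k -> probability 'rV[R]_d R).
Hypotheses (k_gt0 : (0 < k)%N) (hQ : balanced_mixture Q Qc).

Lemma sum_mixture (A : set 'rV[R]_d) : measurable A ->
  (\sum_(i < k) Qc i A = k%:R%:E * Q A)%E.
Proof.
move=> mA; rewrite hQ// muleA -EFinM divff ?mul1e//.
by rewrite pnatr_eq0 -lt0n.
Qed.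

Lemma component_le_mixture i (A : set 'rV[R]_d) : measurable A ->
  (Qc i A <= k%:R%:E * Q A)%E.
Proof.
move=> mA; rewrite -sum_mixture// (bigD1 i)//= leeDl//.
exact: sume_ge0.
Qed.

(** Distinct [i] and [j] give two different terms of the sum over all classes; the remaining terms
    are nonnegative. *)
Lemma component_add_le_mixture i j (A : set 'rV[R]_d) : j != i ->
  measurable A -> (Qc i A + Qc j A <= k%:R%:E * Q A)%E.
Proof.
move=> ji mA; rewrite -sum_mixture// (bigD1 i)//= (bigD1 j)//= addeA leeDl//.
exact: sume_ge0.
Qed.

Let kQ := mscale (k%:R)%:nng Q.

(** Each class is dominated by [kQ], so integrability passes from [Q] to the classes. *)
Lemma has_mean_component (f : 'rV[R]_d -> 'rV[R]_p) i :
  has_mean f Q -> has_mean f (Qc i).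
Proof.
move=> hf j; have /integrableP[mf foo] := hf j.
apply/integrableP; split => //.
apply: (@le_lt_trans _ _ (\int[kQ]_x `|(f x 0 j)%:E|)%E).
  apply: ge0_le_measure_integral => //; last exact: measurableT_comp.
  by move=> A mA; exact: component_le_mixture.
rewrite ge0_integral_mscale//; last exact: measurableT_comp.
by rewrite lte_mul_pinfty.
Qed.

Lemma Var_component_add_le (f : 'rV[R]_d -> 'rV[R]_p) i j : j != i ->
  has_mean f Q -> (Var f (Qc i) + Var f (Qc j) <= k%:R%:E * Var f Q)%E.
Proof.
move=> ji hf; pose g x := (enorm (mean f Q - f x) ^+ 2)%:E.
have g_ge0 x : (0 <= g x)%E by rewrite lee_fin sqr_ge0.
have mg : measurable_fun setT g.
  by apply/measurable_EFinP; exact: measurable_enorm_sqr hf.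
(* Centring both classes at the mean of [Q] leaves a single integrand [g], so only the measures
   remain to be compared. *)
apply: (@le_trans _ _ (\int[Qc i]_x g x + \int[Qc j]_x g x)%E).
  by apply: leeD; apply: Var_le_mean_square; exact: has_mean_component.
rewrite -ge0_integral_measure_add// [X in (_ <= _ * X)%E]/Var unlock.
rewrite -[leRHS](ge0_integral_mscale Q measurableT (k%:R)%:nng mg)//.
apply: ge0_le_measure_integral => // A mA.
rewrite [leLHS]measure_addE.
exact: component_add_le_mixture.
Qed.

End mixture.

Lemma inver_ge0 (R : realType) (r : R) : 0 <= r -> (0 <= r%:E^-1)%E.
Proof. by move=> r0; rewrite inver; case: ifP => // _; rewrite lee_fin invr_ge0. Qed.

(** The factor 1/2 is given up here. At [r = 0], the case of coinciding class means, both sides are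
    [+oo]. *)
Lemma inver_double_le (R : realType) (r : R) : 0 <= r ->
  ((2 * r)%:E^-1 <= r%:E^-1)%E.
Proof.
move=> r0; rewrite !inver mulf_eq0 pnatr_eq0 /=.
case: eqVneq => // rN0; rewrite lee_fin invfM.
by rewrite ler_piMl ?invr_ge0// invf_le1//; lra.
Qed.

Theorem proposition4p1 (R : realType) (d p k : nat) (hk : (2 <= k)%N)
  (Q : probability 'rV[R]_d R) (Qc : 'I_k -> probability 'rV[R]_d R)
  (q : 'I_k -> 'rV[R]_d -> R)
  (hq : forall i, has_density (Qc i) (q i))
  (hQ : balanced_mixture Q Qc)
  (c : R) (hc : poincare Q c)
  (f : 'rV[R]_d -> 'rV[R]_p)
  (hf : forall x, differentiable f x) (hfQ : has_mean f Q) :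
  (NC f Qc <= c%:E * GC f Q / (k%:R - 1)%R%:E *
     \sum_(i < k) \sum_(j < k | j != i)
        ((enorm (mean f (Qc i) - mean f (Qc j)) ^+ 2)%R%:E)^-1)%E.
Proof.
have k_gt0 : (0 < k)%N by exact: ltnW.
have kR0 : (k%:R : R) != 0 by rewrite pnatr_eq0 -lt0n.
have k1 : (0 : R) < k%:R - 1 by rewrite subr_gt0 ltr1n.
have VarQ : (Var f Q <= c%:E * GC f Q)%E by apply: hc.
pose w i j := ((enorm (mean f (Qc i) - mean f (Qc j)) ^+ 2)%R%:E^-1)%E.
have w_ge0 i j : (0 <= w i j)%E by rewrite inver_ge0 ?sqr_ge0.
set S := (\sum_(i < k) _)%R.
have S_ge0 : (0 <= S)%E by do 2!apply: sume_ge0 => ? _; exact: w_ge0.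
have V_le i j : j != i -> (V f (Qc i) (Qc j) <= k%:R%:E * Var f Q * w i j)%E.
  move=> ji; apply: lee_pmul.
  - by rewrite adde_ge0 ?Var_ge0.
  - by rewrite inver_ge0// mulr_ge0 ?sqr_ge0.
  - exact: Var_component_add_le.
  - by rewrite inver_double_le ?sqr_ge0.
have kN0 : k%:R * (k%:R - 1) != 0 :> R by rewrite mulf_neq0// gt_eqF.
(* The bound is first summed with [Var f Q]; then [k] cancels against the averaging factor, leaving
   1/(k-1), and [VarQ] brings in [c] and [GC f Q]. *)
apply: (@le_trans _ _ ((k%:R * (k%:R - 1))%:E^-1 *
    (k%:R%:E * Var f Q * S))%E).
  apply: lee_wpmul2l; first by rewrite inver_ge0// mulr_ge0// ltW.
  rewrite ge0_sume_distrr; last by move=> i _; apply: sume_ge0 => j _; exact: w_ge0.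
  apply: lee_sum => i _; rewrite ge0_sume_distrr; last by move=> j _; exact: w_ge0.
  by apply: lee_sum => j ji; exact: V_le.
rewrite !inver (negbTE kN0) gt_eqF// !muleA -EFinM.
apply: lee_wpmul2r => //.
rewrite invfM mulrAC mulVf// mul1r muleC.
by apply: lee_wpmul2r => //; rewrite lee_fin invr_ge0 ltW.
Qed.
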